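(* Let $n$ be a positive integer with $2pq\mid n$, where $p$ and $q$ are two distinct odd primes, and let $S\subseteq\mathbb{Z}_n\setminus\{0\}$ with $S=-S$ (elements viewed as integers in $\{1,\ldots,n-1\}$). If the circulant graph $\mathrm{Cay}(\mathbb{Z}_n,S)$ exhibits PGFR, then there exists $y\in S$ such that $p\mid y$ or $q\mid y$.
   Context: The circulant graph $\mathrm{Cay}(\mathbb{Z}_n,S)$ has vertex set $\mathbb{Z}_n$, two distinct vertices $a,b$ being adjacent iff $b-a\in S$. For a graph $\Gamma$ with adjacency matrix $A$, the transition matrix is $H(t)=\exp(-\mathbf{i}tA)$, $t\in\mathbb{R}$, and $\mathbf{e}_v$ is the standard basis vector of vertex $v$. $\Gamma$ exhibits pretty good fractional revival (PGFR) between distinct vertices $a$ and $b$ if there is a sequence of real numbers $\{t_k\}$ with $\lim_{k\to\infty}H(t_k)\mathbf{e}_a=\alpha\mathbf{e}_a+\beta\mathbf{e}_b$ for some $\alpha,\beta\in\mathbb{C}$ with $\beta\neq0$ and $|\alpha|^2+|\beta|^2=1$; $\Gamma$ exhibits PGFR if it does so between some pair of distinct vertices. *)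

(* Defs.v *)
From HB Require Import structures.
From mathcomp Require Import all_boot all_order all_algebra.
From mathcomp Require Import all_classical all_reals all_analysis.
From mathcomp Require Import complex.

Set Implicit Arguments.
Unset Strict Implicit.
Unset Printing Implicit Defensive.

Import Order.TTheory GRing.Theory Num.Theory.
Import numFieldNormedType.Exports.

Local Open Scope classical_set_scope.
Local Open Scope ring_scope.
Local Open Scope complex_scope.

(* The topology on complex matrices is the library's one on matrices over an
   abstract numClosedFieldType, so R[i] is bundled as such a structure. *)
Definition Cplx (R : realType) : numClosedFieldType := R[i].

(* 'M_m carries the topology of entrywise convergence. *)
Definition mxexp (R : realType) (m : nat) (X : 'M[Cplx R]_m) : 'M[Cplx R]_m :=
  limn (series (fun k : nat => (k`!%:R)^-1 *: X ^+ k)).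

Section Graph.

Variables (R : realType) (m : nat) (adj : rel 'I_m).

Definition adjacency_mx : 'M[Cplx R]_m := \matrix_(a, b) (adj a b)%:R.

Definition transition_mx (t : R) : 'M[Cplx R]_m :=
  mxexp ((- ('i%C * t%:C) : Cplx R) *: adjacency_mx).

Definition basis_vec (v : 'I_m) : 'cV[Cplx R]_m := delta_mx v 0.

Definition PGFR_between (a b : 'I_m) : Prop :=
  a <> b /\
  exists (t : nat -> R) (alpha beta : Cplx R),
    [/\ (fun k => transition_mx (t k) *m basis_vec a) @ \oo -->
          alpha *: basis_vec a + beta *: basis_vec b,
        beta != 0 &
        `|alpha| ^+ 2 + `|beta| ^+ 2 = 1].

Definition PGFR : Prop := exists a b : 'I_m, PGFR_between a b.

End Graph.

(* 'Z_n is Z/nZ only for 1 < n. *)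
Definition circulant (n : nat) (S : {set 'Z_n}) : rel 'Z_n :=
  fun a b => (a != b) && (b - a \in S).

(* Main.v *)
(* Write theta_j, the sum of w^(j s) over s in S, for the eigenvalues of the
   circulant graph, w being a primitive n-th root of unity.  In the Fourier
   basis, PGFR between a and b says that exp(-i t_k theta_j) tends to
   alpha + beta z^j for all j, where z = w^(b - a).  As theta_j = theta_(-j) and
   beta <> 0, z^2 = 1, so z = -1.  If p divides no element of S, the sum of
   theta over the coset j + (n/p)Z vanishes; n/p being even, z^j is constant on
   this coset, so (alpha + beta z^j)^p = 1.  If the same holds for q, then
   coprimality gives alpha + beta = alpha + beta z = 1, contradicting z <> 1. *)
Require Import Defs.
From mathcomp Require Import all_boot all_order all_algebra.
From mathcomp Require Import cyclic separable cyclotomic.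
From mathcomp Require Import all_classical all_reals all_analysis.
From mathcomp Require Import complex ring.

Set Implicit Arguments.
Unset Strict Implicit.
Unset Printing Implicit Defensive.

Import Order.TTheory GRing.Theory Num.Theory.
Import numFieldNormedType.Exports.

Local Open Scope classical_set_scope.
Local Open Scope ring_scope.
Local Open Scope complex_scope.

(** * Entrywise limits and the matrix exponential *)

Lemma cvg_mx (T : topologicalType) (m n : nat) (U : Type)
    (F : set_system U) (FF : Filter F) (f : U -> 'M[T]_(m, n)) (L : 'M[T]_(m, n)) :
  (forall i j, f x i j @[x --> F] --> L i j) -> f x @[x --> F] --> L.
Proof.
move=> fL A [P LP PA]; apply: filterS PA _.
rewrite nbhs_filterE /=.
have : \forall x \near F, forall ij : 'I_m * 'I_n, P ij.1 ij.2 (f x ij.1 ij.2).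
  by apply: filter_forall => -[i j] /=; apply: fL.
by apply: filterS => x Px i j; exact: (Px (i, j)).
Qed.

Section Cis.
Variable R : realType.
Implicit Types x y : R.

Lemma cvg_complex (a b : nat -> R) (x y : R) :
  a @ \oo --> x -> b @ \oo --> y ->
  (fun k => (a k +i* b k : Cplx R)) @ \oo --> (x +i* y : Cplx R).
Proof.
move=> ax bY; apply/cvgrPdist_lt => e e0.
(* The tolerance [e] is a positive complex number, hence real; its real part serves as a bound in
   [R]. *)
have eR : e = (complex.Re e)%:C by rewrite RRe_real // gtr0_real.
have {}e0 : 0 < complex.Re e by rewrite -ltcR -eR.
have e2 : 0 < complex.Re e / 2 by rewrite divr_gt0.
near=> k.
have xk : `|x - a k| < complex.Re e / 2.
  by near: k; exact: (@cvgrPdist_lt _ _ _ _ _ _ _).1 ax _ e2.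
have yk : `|y - b k| < complex.Re e / 2.
  by near: k; exact: (@cvgrPdist_lt _ _ _ _ _ _ _).1 bY _ e2.
have -> : (x +i* y : Cplx R) - (a k +i* b k : Cplx R) =
          ((x - a k)%:C + 'i%C * (y - b k)%:C : R[i]).
  by rewrite [RHS](complexE) [LHS]complexE /=; simpc.
rewrite eR (le_lt_trans (ler_normD _ _)) // normrM.
rewrite !normc_def /= !expr0n /= expr1n !addr0 add0r sqrtr1 mul1r !sqrtr_sqr.
by rewrite -rmorphD ltcR [ltRHS]splitr ltrD.
Unshelve. all: by end_near. Qed.

Definition cis x : Cplx R := cos x +i* sin x.

Lemma cis0 : cis 0 = 1.
Proof. by rewrite /cis cos0 sin0. Qed.

Lemma cisD x y : cis (x + y) = cis x * cis y.
Proof.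
by rewrite /cis cosD sinD; apply/eqP; rewrite eq_complex /= eqxx /= addrC.
Qed.

Lemma cis_sum (I : Type) (r : seq I) (P : pred I) (F : I -> R) :
  cis (\sum_(i <- r | P i) F i) = \prod_(i <- r | P i) cis (F i).
Proof. by apply: big_morph; [exact: cisD|exact: cis0]. Qed.

(** Since i^k = i^(odd k) (-1)^(k/2), the real and imaginary parts of the exponential series are,
    term by term, the cosine and sine series. *)
Lemma cvg_cis x :
  series (fun k => (k`!%:R)^-1 * ('i%C * x%:C) ^+ k : Cplx R) @ \oo --> cis x.
Proof.
have coeffE k : (k`!%:R)^-1 * ('i%C * x%:C) ^+ k =
    cos_coeff x k +i* sin_coeff x k :> R[i].
  rewrite exprMn -rmorphXn -(rmorph_nat (real_complex R)) -fmorphV.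
  rewrite [_ * (_ * _)]mulrCA -rmorphM.
  have -> : ('i%C : R[i]) ^+ k = 'i%C ^+ odd k * (-1) ^+ k./2.
    by rewrite -[in LHS](odd_double_half k) exprD -mul2n exprM sqr_i.
  have -> : (-1 : R[i]) ^+ k./2 = ((-1) ^+ k./2)%:C by rewrite rmorphXn rmorphN1.
  rewrite -mulrA -rmorphM.
  rewrite /cos_coeff /sin_coeff /=; have [odd_k|even_k] := boolP (odd k).
    (* [sin_coeff] halves k - 1 where the formula above halves k; for odd k these agree. *)
    have -> : k.-1./2 = k./2.
      by case: (k) odd_k => //= l; rewrite uphalf_half => /negPf ->.
    rewrite expr1 /=; apply/eqP; rewrite eq_complex /=.
    by apply/andP; split; apply/eqP; ring.
  rewrite mul1r; apply/eqP; rewrite eq_complex /= -exprnP.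
  by apply/andP; split; apply/eqP; ring.
have -> : series (fun k => (k`!%:R)^-1 * ('i%C * x%:C) ^+ k : Cplx R) =
    fun k => series (cos_coeff x) k +i* series (sin_coeff x) k.
  apply/funext => k; rewrite /series /=.
  rewrite (eq_bigr (fun k => cos_coeff x k +i* sin_coeff x k : R[i])) => [|i _].
    elim: k => [|k IH]; first by rewrite !big_geq.
    by rewrite 3?big_nat_recr /= ?IH.
  exact: coeffE.
rewrite /cis !unlock; apply: cvg_complex.
  exact: is_cvg_series_cos_coeff.
exact: is_cvg_series_sin_coeff.
Qed.

(** As [G] and [F] are mutually inverse, powers of the conjugate act on the diagonal alone, so each
    entry of a partial sum is a finite combination of scalar exponential series. *)
Lemma mxexp_diag (m : nat) (G F : 'M[Cplx R]_m.+1) (d : 'I_m.+1 -> R) :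
  F *m G = 1%:M ->
  mxexp (G *m diag_mx (\row_j ('i%C * (d j)%:C : Cplx R)) *m F) =
  G *m diag_mx (\row_j cis (d j)) *m F.
Proof.
move=> FG; have GF := mulmx1C FG.
set X := G *m _ *m F.
have XE k : X ^+ k = G *m diag_mx (\row_j ('i%C * (d j)%:C : Cplx R) ^+ k) *m F.
  elim: k => [|k IH].
    rewrite expr0 (_ : \row_j _ = const_mx 1); last by apply/rowP => j; rewrite !mxE.
    by rewrite diag_const_mx mulmx1 GF.
  rewrite exprSr IH -mulmxE /X !mulmxA -(mulmxA _ F G) FG mulmx1 -(mulmxA G) mulmx_diag.
  by congr (G *m diag_mx _ *m F); apply/rowP => j; rewrite !mxE exprSr.
have entryE (D : 'rV[Cplx R]_m.+1) i j :
    (G *m diag_mx D *m F) i j = \sum_l G i l * D 0 l * F l j.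
  by rewrite mul_mx_diag mxE; apply: eq_bigr => l _; rewrite mxE.
apply: cvg_lim; first exact: norm_hausdorff.
apply: cvg_mx => i j; rewrite entryE.
rewrite [X in X @ _ --> _](_ : _ = fun N => \sum_l G i l *
  series (fun k => (k`!%:R)^-1 * ('i%C * (d l)%:C) ^+ k : Cplx R) N * F l j).
  apply: cvg_big; first exact: add_continuous.
  move=> l _; rewrite mxE; apply: cvgMl; apply: cvgMr; exact: cvg_cis.
apply/funext => N; rewrite summxE /series.
under eq_bigr do rewrite mxE XE entryE mulr_sumr.
rewrite exchange_big /=; apply: eq_bigr => l _.
rewrite mulr_sumr mulr_suml; apply: eq_bigr => k _; rewrite mxE; ring.
Qed.
End Cis.

(** * Roots of unity *)

(** X^n - 1 is separable in characteristic 0, so it has n distinct roots, enough to force a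
    primitive one. *)
Lemma prim_root_exists (C : numClosedFieldType) (n : nat) :
  (0 < n)%N -> exists w : C, n.-primitive_root w.
Proof.
pose p : {poly C} := 'X^n - 1; have [r Dp] := closed_field_poly_normal p.
move=> n_gt0; rewrite (monicP _) ?monicXnsubC // scale1r in Dp.
have rn1 : all n.-unity_root r by apply/allP => z; rewrite -root_prod_XsubC -Dp.
have sz_r : (n < (size r).+1)%N.
  by rewrite -(size_prod_XsubC r id) -Dp size_XnsubC.
have [|z] := hasP (has_prim_root n_gt0 rn1 _ sz_r); last by exists z.
rewrite -separable_prod_XsubC -Dp separable_Xn_sub_1 //.
by rewrite pnatr_eq0 -lt0n.
Qed.

Lemma sum_unity_root (K : fieldType) (n : nat) (z : K) :
  z ^+ n = 1 -> z != 1 -> \sum_(i < n) z ^+ i = 0.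
Proof.
move=> zn z1; have := subrX1 z n; rewrite zn subrr => /esym/eqP.
by rewrite mulf_eq0 subr_eq0 (negPf z1) /= => /eqP.
Qed.

(** Bezout: u p = v q + 1 for some u and v. *)
Lemma coprime_expr1 (K : fieldType) (p q : nat) (x : K) :
  coprime p q -> (0 < p)%N -> x ^+ p = 1 -> x ^+ q = 1 -> x = 1.
Proof.
move=> cpq p0 xp xq; have [u v uv _] := egcdnP q p0.
have : x ^+ (u * p) = 1 by rewrite mulnC exprM xp expr1n.
rewrite uv (eqP cpq) exprD mulnC exprM xq expr1n mul1r; exact.
Qed.

(** * Fourier diagonalisation of the circulant graph *)

Section Circulant.
Variables (R : realType) (m : nat).
Local Notation n := m.+2.
Variables (w : Cplx R) (S : {set 'I_n}).
Hypothesis w_prim : n.-primitive_root w.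
Hypothesis S_nz : 0 \notin S.
Hypothesis S_sym : forall x : 'I_n, (- x \in S) = (x \in S).

Let w_neq0 : w != 0.
Proof. by rewrite (prim_root_eq0 w_prim). Qed.

Let w_ord_neq0 (x : 'I_n) : w ^+ x != 0.
Proof. by rewrite expf_neq0. Qed.

Let w_add (x y : 'I_n) : w ^+ (x + y)%R = w ^+ x * w ^+ y.
Proof. by rewrite (prim_expr_mod w_prim) exprD. Qed.

Let w_opp (x : 'I_n) : w ^+ (- x)%R = w ^- x.
Proof.
by apply: (mulIf (w_ord_neq0 x)); rewrite -w_add addNr mulVf.
Qed.

Let w_ord_expn (x : 'I_n) : (w ^+ x) ^+ n = 1.
Proof. by rewrite exprAC (prim_expr_order w_prim) expr1n. Qed.

Definition circ_eigenvalue (j : nat) : Cplx R := \sum_(s in S) (w ^+ s) ^+ j.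

(** The reindexing s -> -s is where S = -S enters; it makes the eigenvalues real and lets the sign
    of Fourier exponents be switched. *)
Lemma circ_eigenvalueV (j : nat) :
  \sum_(s in S) (w ^+ s) ^- j = circ_eigenvalue j.
Proof.
rewrite [RHS](reindex_inj oppr_inj) /=; apply: eq_big => s; first by rewrite S_sym.
by rewrite w_opp exprVn.
Qed.

(** [w] has modulus 1, so conjugation inverts its powers and [circ_eigenvalueV] applies. *)
Lemma circ_eigenvalue_real (j : nat) :
  circ_eigenvalue j = (complex.Re (circ_eigenvalue j))%:C.
Proof.
rewrite RRe_real //; apply/CrealP.
rewrite -[in RHS]circ_eigenvalueV rmorph_sum /=; apply: eq_bigr => s _.
rewrite !rmorphXn /= -!exprVn; congr (_ ^+ _ ^+ _).
have w1 : `|w| = 1.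
  have /eqP := congr1 Num.norm (prim_expr_order w_prim).
  by rewrite normrX normr1 pexpr_eq1 // => /eqP.
by rewrite invC_norm w1 expr1n invr1 mul1r.
Qed.

Definition circ_freq (j : nat) : R := complex.Re (circ_eigenvalue j).

(** The discrete Fourier transform; [G] below is its inverse. *)
Let F : 'M[Cplx R]_n := \matrix_(j, a) (w ^+ a) ^+ j.
Let G : 'M[Cplx R]_n := \matrix_(a, j) (n%:R^-1 * (w ^+ a) ^- j).

(** Orthogonality of characters: for j <> l the ratio of w^j and w^l is an n-th root of unity other
    than 1, so its geometric sum vanishes. *)
Let FG : F *m G = 1%:M.
Proof.
apply/matrixP => j l; rewrite !mxE.
under eq_bigr => a _.
  rewrite !mxE mulrCA exprAC (exprAC w a l) -expr_div_n; over.
rewrite -mulr_sumr; have [<-|jl] := eqVneq j l.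
  rewrite divff // (eq_bigr (fun=> 1)) => [|i _]; last by rewrite expr1n.
  by rewrite sumr_const card_ord mulVf // pnatr_eq0.
rewrite sum_unity_root ?mulr0 //.
  by rewrite expr_div_n !w_ord_expn divr1.
apply: contra jl => /eqP/(canRL (divfK (w_ord_neq0 l))); rewrite mul1r => /eqP.
by rewrite (eq_prim_root_expr w_prim) !modn_small.
Qed.

(** Rows of [F] are left eigenvectors: the neighbours of b are b - s with s in S, and row j at b - s
    is its value at b times w^(-js). *)
Let F_adjacency :
  F *m adjacency_mx R (@circulant n S) = diag_mx (\row_j circ_eigenvalue j) *m F.
Proof.
rewrite mul_diag_mx; apply/matrixP => j b; rewrite !mxE.
rewrite -circ_eigenvalueV mulr_suml [LHS](reindex_inj (subrI b)) /= [RHS]big_mkcond /=.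
apply: eq_bigr => s _; rewrite !mxE /circulant subKr.
have [sS|] := boolP (s \in S); last by rewrite andbF mulr0.
have -> : b - s != b.
  rewrite -subr_eq0 addrC addKr oppr_eq0.
  by apply: contraNneq S_nz => <-.
by rewrite mulr1 w_add w_opp exprMn exprVn mulrC.
Qed.

Let transition_fourier (t : R) : F *m transition_mx (@circulant n S) t =
  diag_mx (\row_j cis (- t * circ_freq j)) *m F.
Proof.
have -> : transition_mx (@circulant n S) t =
    G *m diag_mx (\row_j cis (- t * circ_freq j)) *m F.
  rewrite /transition_mx -(mxexp_diag _ FG); congr mxexp.
  rewrite -[adjacency_mx _ _]mul1mx -(mulmx1C FG) -(mulmxA G F) F_adjacency mulmxA.
  rewrite scalemxAl scalemxAr; congr (_ *m _ *m _).
  apply/matrixP => i j; rewrite !mxE mulrnAr; congr (_ *+ _).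
  rewrite circ_eigenvalue_real -/(circ_freq _) rmorphM rmorphN.
  by rewrite mulNr mulNr mulrN mulrA.
by rewrite !mulmxA FG mul1mx.
Qed.

(** This is coordinate j after applying [F], which turns the transition matrix into the scalar
    [cis (- t k * circ_freq j)]; the factor (w^a)^j is then divided out. *)
Lemma PGFR_cvg_cis (t : nat -> R) (alpha beta : Cplx R) (a b : 'I_n) (j : nat) :
  (j < n)%N ->
  (fun k => transition_mx (@circulant n S) (t k) *m basis_vec R a) @ \oo -->
    alpha *: basis_vec R a + beta *: basis_vec R b ->
  cis (- t k * circ_freq j) @[k --> \oo] -->
    alpha + beta * (w ^+ (b - a)%R) ^+ j.
Proof.
move=> jn H; pose j' := Ordinal jn.
have Fv (c : 'I_n) (D : 'M[Cplx R]_n) : (D *m basis_vec R c) j' 0 = D j' c.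
  by rewrite -colE mxE.
have HF k : (F *m (transition_mx (@circulant n S) (t k) *m basis_vec R a)) j' 0 =
    cis (- t k * circ_freq j) * (w ^+ a) ^+ j.
  by rewrite mulmxA transition_fourier Fv mul_diag_mx !mxE.
have HL : (F *m (alpha *: basis_vec R a + beta *: basis_vec R b)) j' 0 =
    alpha * (w ^+ a) ^+ j + beta * (w ^+ b) ^+ j.
  by rewrite mulmxDr -!scalemxAr mxE [X in X + _]mxE [X in _ + X]mxE !Fv !mxE.
have {}H : cis (- t k * circ_freq j) * (w ^+ a) ^+ j @[k --> \oo] -->
    alpha * (w ^+ a) ^+ j + beta * (w ^+ b) ^+ j.
  rewrite -HL; under eq_fun do rewrite -HF mxE.
  rewrite mxE; apply: cvg_big => [|i _]; first exact: add_continuous.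
  by apply: cvgMr; exact: (cvg_comp _ _ H (@coord_continuous (Cplx R) _ _ i 0 _)).
have -> : (fun k => cis (- t k * circ_freq j)) =
    (fun k => cis (- t k * circ_freq j) * (w ^+ a) ^+ j * (w ^+ a) ^- j).
  by apply/funext => k; rewrite mulfK // expf_neq0.
have -> : alpha + beta * (w ^+ (b - a)%R) ^+ j =
    (alpha * (w ^+ a) ^+ j + beta * (w ^+ b) ^+ j) * (w ^+ a) ^- j.
  by rewrite mulrDl mulfK ?expf_neq0 // w_add w_opp exprMn exprVn mulrA.
exact: cvgMl.
Qed.

(** After exchanging the sums, each s contributes a geometric sum of ratio w^(s n/p), a p-th root of
    unity that differs from 1 because p does not divide s. *)
Lemma circ_freq_coset_sum (p j : nat) :
  (p %| n)%N -> (forall s : 'I_n, s \in S -> ~~ (p %| s)%N) ->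
  \sum_(i < p) circ_freq (j + i * (n %/ p)) = 0.
Proof.
move=> pn pS; apply: (@complexI R); rewrite rmorph_sum rmorph0 /=.
under eq_bigr do rewrite /circ_freq -circ_eigenvalue_real.
rewrite exchange_big big1 //= => s sS.
under eq_bigr do rewrite exprD mulnC exprM.
rewrite -mulr_sumr sum_unity_root ?mulr0 //.
  by rewrite -[LHS]exprM divnK // w_ord_expn.
rewrite -exprM -(prim_order_dvd w_prim) -[X in (X %| _)%N](divnK pn) mulnC.
rewrite dvdn_pmul2r; first exact: pS.
have p_gt0 : (0 < p)%N := dvdn_gt0 (ltn0Sn _) pn.
by rewrite divn_gt0 // (dvdn_leq _ pn).
Qed.

Lemma cis_coset_prod (p j : nat) (t : R) :
  (p %| n)%N -> (forall s : 'I_n, s \in S -> ~~ (p %| s)%N) ->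
  \prod_(i < p) cis (t * circ_freq (j + i * (n %/ p))) = 1.
Proof.
by move=> pn pS; rewrite -cis_sum -mulr_sumr circ_freq_coset_sum // mulr0 cis0.
Qed.

(** * Constraints on the limit under PGFR *)

Section Limit.
Variables (a b : 'I_n) (t : nat -> R) (alpha beta : Cplx R).
Hypothesis a_neq_b : a <> b.
Hypothesis beta_neq0 : beta != 0.
Hypothesis transition_cvg :
  (fun k => transition_mx (@circulant n S) (t k) *m basis_vec R a) @ \oo -->
    alpha *: basis_vec R a + beta *: basis_vec R b.

Let z := w ^+ (b - a)%R.

Lemma PGFR_char_neq1 : z != 1.
Proof.
apply/eqP => z1; apply/a_neq_b/val_inj/eqP => /=.
have : w ^+ a == w ^+ b by rewrite -[b](subrK a) w_add -/z z1 mul1r.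
by rewrite (eq_prim_root_expr w_prim) !modn_small.
Qed.

Lemma PGFR_char_sqr : z ^+ 2 = 1.
Proof.
have zn : z ^+ n = 1 by exact: w_ord_expn.
(* theta_(-1) = theta_1 because S = -S. *)
have freqE : circ_freq m.+1 = circ_freq 1.
  rewrite /circ_freq -(circ_eigenvalueV 1); congr complex.Re.
  apply: eq_bigr => s _; apply: (mulIf (w_ord_neq0 s)).
  by rewrite -exprSr w_ord_expn expr1 mulVf.
have := PGFR_cvg_cis (ltnSn m.+1) transition_cvg; rewrite freqE.
have /[swap] := PGFR_cvg_cis (isT : (1 < n)%N) transition_cvg.
(* Equating the two limits and cancelling alpha and beta leaves z^(n-1) = z. *)
move=> /(cvg_unique (@norm_hausdorff _ _))/[apply] /addrI /(mulfI beta_neq0).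
by rewrite expr1 -/z => /(congr1 ( *%R z)); rewrite -exprS zn -expr2.
Qed.

(** The p phases on the coset multiply to 1 for every k, hence so do their limits. As n/p is even,
    z^(n/p) = 1 and the p limits coincide. *)
Lemma PGFR_limit_unity (p j : nat) :
  (p %| n)%N -> ~~ odd (n %/ p) -> (j < n %/ p)%N ->
  (forall s : 'I_n, s \in S -> ~~ (p %| s)%N) ->
  (alpha + beta * z ^+ j) ^+ p = 1.
Proof.
move=> pn even_np jnp pS.
have z1 : z ^+ (n %/ p) = 1.
  rewrite -(odd_double_half (n %/ p)) (negPf even_np) -mul2n exprM.
  by rewrite PGFR_char_sqr expr1n.
have lim1 : \prod_(i < p) cis (- t k * circ_freq (j + i * (n %/ p))) @[k --> \oo]
    --> \prod_(i < p) (alpha + beta * z ^+ (j + i * (n %/ p))).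
  apply: cvg_big => [|i _]; first exact: mul_continuous.
  apply: PGFR_cvg_cis transition_cvg.
  (* [PGFR_cvg_cis] asks for indices below n: j + i n/p < (i+1) n/p <= n. *)
  have le_ip : (i.+1 * (n %/ p) <= p * (n %/ p))%N by rewrite leq_mul2r ltn_ord orbT.
  rewrite -[X in (_ < X)%N](divnK pn) [X in (_ < X)%N]mulnC.
  by apply: leq_trans le_ip; rewrite mulSn -addSn leq_add2r.
have := cvg_unique (@norm_hausdorff _ _) lim1.
under eq_fun do rewrite cis_coset_prod //.
move=> /(_ _ _ (cvg_cst _)).
rewrite (eq_bigr (fun=> alpha + beta * z ^+ j)) => [|i _].
  by rewrite prodr_const card_ord.
by rewrite exprD [(i * _)%N]mulnC exprM z1 expr1n mulr1.
Qed.
End Limit.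
End Circulant.

Local Close Scope classical_set_scope.
Local Close Scope complex_scope.

Theorem theorem4p11 (R : realType) (n p q : nat) (S : {set 'Z_n})
  (n_gt0 : (0 < n)%N)
  (p_prime : prime p) (p_odd : odd p)
  (q_prime : prime q) (q_odd : odd q)
  (p_neq_q : p <> q)
  (dvd_n : (2 * p * q %| n)%N)
  (S_nz : 0 \notin S)
  (S_sym : forall x : 'Z_n, (- x \in S) = (x \in S))
  (S_PGFR : PGFR R (circulant S)) :
  exists2 y : 'Z_n, y \in S & (p %| y)%N \/ (q %| y)%N.
Proof.
(* For n >= 2, ['Z_n] is ['I_n] by conversion; n = 0 is excluded, and n = 1 is not a multiple of
   2pq. *)
case: n => [|[|m]] // in S n_gt0 dvd_n S_nz S_sym S_PGFR *.
  move: dvd_n; rewrite dvdn1 !muln_eq1.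
  by case: eqP p_odd => // ->.
(* Stated so as to serve p and q alike. The quotient n/r is even and positive, so both indices 0 and
   1 lie below it. *)
have quotient r s : prime r -> (2 * r * s %| m.+2)%N ->
    [/\ (r %| m.+2)%N, ~~ odd (m.+2 %/ r) & (1 < m.+2 %/ r)%N].
  move=> r_prime /dvdnP[k nE]; have r_gt0 := prime_gt0 r_prime.
  have nE' : m.+2 = (k * s * 2 * r)%N by rewrite nE; ring.
  have even_nr : ~~ odd (m.+2 %/ r) by rewrite nE' mulnK // oddM andbF.
  have r_dvd : (r %| m.+2)%N by rewrite nE' dvdn_mull.
  have nr_gt0 : (0 < m.+2 %/ r)%N by rewrite divn_gt0 // dvdn_leq.
  by split=> //; case: (_ %/ _)%N nr_gt0 even_nr => [|[]].
have [p_dvd p_even p_lt] := quotient p q p_prime dvd_n.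
have [|q_dvd q_even q_lt] := quotient q p q_prime; first by rewrite mulnAC.
apply: contrapT => no_y.
have pS (s : 'I_m.+2) : s \in S -> ~~ (p %| s)%N.
  by move=> sS; apply/negP => ps; apply: no_y; exists s; [|left].
have qS (s : 'I_m.+2) : s \in S -> ~~ (q %| s)%N.
  by move=> sS; apply/negP => qs; apply: no_y; exists s; [|right].
have [w w_prim] := prim_root_exists (Cplx R) (ltn0Sn m.+1).
have [a [b [a_neq_b [t [alpha [beta [H beta_neq0 _]]]]]]] := S_PGFR.
have copq : coprime p q by rewrite prime_coprime // dvdn_prime2 //; apply/eqP.
pose z := w ^+ (b - a)%R.
have lim1 j : (j < 2)%N -> alpha + beta * z ^+ j = 1.
  move=> j2; apply: (coprime_expr1 copq (prime_gt0 p_prime)).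
    apply: (PGFR_limit_unity w_prim S_nz S_sym beta_neq0 H p_dvd) => //.
    exact: leq_trans p_lt.
  apply: (PGFR_limit_unity w_prim S_nz S_sym beta_neq0 H q_dvd) => //.
  exact: leq_trans q_lt.
(* Indices 0 and 1 give alpha + beta = alpha + beta z; cancelling yields z = 1, against a <> b. *)
have := lim1 0%N isT; rewrite -(lim1 1%N isT) => /addrI /(mulfI beta_neq0).
by move=> /esym/eqP; rewrite expr0 expr1 (negPf (PGFR_char_neq1 w_prim a_neq_b)).
Qed.
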